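(* Let $K$ be a field, $X=\{x_1,\ldots,x_n\}$, let $\sigma$ be a permutation of $\{1,\ldots,n\}$ of order $k$ such that $\operatorname{char}(K)\nmid k$ and $K$ contains a primitive $k$-th root of unity $\xi_k$, and let $\sigma_\tau=\tau\sigma\tau^{-1}\in\operatorname{Aut}(K[X])$ be the automorphism defined in the context. Let $I_\tau\subseteq K[X]$ be a $\sigma_\tau$-symmetric ideal. Then the (reduced) Gröbner basis $G_\tau$ of $I_\tau$ satisfies: for every $g_\tau\in G_\tau$ there is an integer $\nu_{g_\tau}$ with $0\le \nu_{g_\tau}\le k-1$ such that $\sigma_\tau(g_\tau)=\xi_k^{\nu_{g_\tau}}\cdot g_\tau$.
   Context: A permutation $\sigma$ of $\{1,\ldots,n\}$ acts on $K[X]=K[x_1,\ldots,x_n]$ as the $K$-algebra automorphism $x_i\mapsto x_{\sigma(i)}$, also denoted $\sigma$. For an automorphism $\varphi$ of $K[X]$, an ideal $I$ is called $\varphi$-symmetric if $\varphi(I)=I$. Write $\sigma$ in cycle decomposition (fixed points are cycles of length $1$): $\sigma=\sigma_1\cdots\sigma_{\vartheta}$ with $\sigma_m=(e_{m,1}\ldots e_{m,l_m})$ for $1\le m\le\vartheta$, where $\{1,\ldots,n\}$ is the disjoint union of the sets $\{e_{m,1},\ldots,e_{m,l_m}\}$. Then $k=\operatorname{lcm}(l_1,\ldots,l_\vartheta)$. Put $\xi_{l_m}:=\xi_k^{k/l_m}$, a primitive $l_m$-th root of unity. Let $\tau$ be the $K$-algebra automorphism of $K[X]$ given by $$\tau(x_{e_{m,i}})=\sum_{j=1}^{l_m}\xi_{l_m}^{(i-1)(j-1)}\,x_{\sigma_m^{j-1}(e_{m,1})}\qquad(1\le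 m\le\vartheta,\ 1\le i\le l_m),$$ and let $\sigma_\tau:=\tau\sigma\tau^{-1}$ (i.e. $\sigma_\tau(f)=\tau(\sigma(\tau^{-1}(f)))$). Gröbner bases are taken with respect to a fixed degree ordering $>$ (a monomial ordering in which a monomial of larger total degree is larger), and are always assumed reduced: $0\notin G$; the leading monomial of $g$ does not divide the leading monomial of $f$ for distinct $f,g\in G$; every $g\in G$ has leading coefficient $1$; and no monomial of $g$ minus its leading term lies in the leading ideal of $G$. *)

(* Defs.v *)
From HB Require Import structures.
From mathcomp Require Import all_boot all_order all_fingroup all_algebra.
From mathcomp Require Import mpoly.

Set Implicit Arguments.
Unset Strict Implicit.
Unset Printing Implicit Defensive.

Import GRing.Theory.
Local Open Scope ring_scope.

Section Ideals.
Variables (n : nat) (K : fieldType).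
Implicit Types (I S : {mpoly K[n]} -> Prop).

(* The unit ideal is allowed, unlike for the [ring_quotient] ideals. *)
Definition is_ideal I : Prop :=
  [/\ I 0,
      forall f g, I f -> I g -> I (f + g)
    & forall f g, I g -> I (f * g)].

Definition ideal_gen S (f : {mpoly K[n]}) : Prop :=
  forall I, is_ideal I -> (forall g, S g -> I g) -> I f.

Definition symmetric_ideal (phi : {mpoly K[n]} -> {mpoly K[n]}) I : Prop :=
  forall f, (exists2 g, I g & f = phi g) <-> I f.

End Ideals.

(* [le m m'] is the non-strict relation m <= m'; for a degree ordering the
   well-foundedness of a monomial ordering is automatic. *)
Definition is_monomial_order n (le : rel 'X_{1..n}) : Prop :=
  [/\ [/\ reflexive le, antisymmetric le, transitive le & total le],
      forall m, le 0%MM m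
    & forall m1 m2 m, le m1 m2 -> le (m1 + m)%MM (m2 + m)%MM].

Definition is_degree_order n (le : rel 'X_{1..n}) : Prop :=
  is_monomial_order le /\
  forall m1 m2, (mdeg m1 < mdeg m2)%N -> le m1 m2.

Section Groebner.
Variables (n : nat) (K : fieldType) (le : rel 'X_{1..n}).
Implicit Types (f g : {mpoly K[n]}) (S I : {mpoly K[n]} -> Prop).

(* The largest monomial of [f] for [le] (junk value 0 when f = 0); the
   library's [mlead] is tied to one particular ordering. *)
Definition lmon f : 'X_{1..n} :=
  \big[(fun m m' => if le m m' then m' else m)/0%MM]_(m <- msupp f) m.

Definition lcoef f : K := f@_(lmon f).

Definition lterm f : {mpoly K[n]} := lcoef f *: 'X_[lmon f].

Definition lead_ideal S : {mpoly K[n]} -> Prop :=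
  ideal_gen (fun h => exists g, [/\ S g, g != 0 & h = 'X_[lmon g]]).

Definition is_groebner_basis (G : seq {mpoly K[n]}) I : Prop :=
  (forall g, g \in G -> I g) /\
  (forall f, lead_ideal (fun g => g \in G) f <-> lead_ideal I f).

Definition is_reduced (G : seq {mpoly K[n]}) : Prop :=
  [/\ 0 \notin G,
      forall f g, f \in G -> g \in G -> f != g -> ~~ (lmon g <= lmon f)%MM,
      forall g, g \in G -> lcoef g = 1
    & forall g m, g \in G -> m \in msupp (g - lterm g) ->
        ~ lead_ideal (fun h => h \in G) 'X_[m]].

Definition is_reduced_groebner_basis G I : Prop :=
  is_groebner_basis G I /\ is_reduced G.

End Groebner.

Section Tau.
Variables (n : nat) (K : fieldType).

(* [cs] lists the cycles (e_{m,1} ... e_{m,l_m}) of [s], fixed points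
   included; both the order of the cycles and the starting point of each cycle
   are free. *)
Definition cycle_decomposition (s : 'S_n) (cs : seq (seq 'I_n)) : Prop :=
  [/\ perm_eq (flatten cs) (enum 'I_n),
      forall c, c \in cs -> c != [::]
    & forall c, c \in cs -> fcycle s c].

(* Indices are shifted to start at 0: [nth e1 (e1 :: c) i] is e_{m,i+1}. *)
Definition tau_spec (s : 'S_n) (cs : seq (seq 'I_n)) (k : nat) (xi : K)
    (tau : {mpoly K[n]} -> {mpoly K[n]}) : Prop :=
  forall (e1 : 'I_n) (c : seq 'I_n), e1 :: c \in cs ->
  let l := size (e1 :: c) in
  forall i, (i < l)%N ->
    tau 'X_(nth e1 (e1 :: c) i) =
      \sum_(j < l) (xi ^+ (k %/ l)) ^+ (i * j) *: 'X_((s ^+ j)%g e1).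

(* [tauV] is the inverse of [tau]; [msym s] maps 'X_i to 'X_(s i). *)
Definition sigma_tau (s : 'S_n) (tau tauV : {mpoly K[n]} -> {mpoly K[n]}) :
    {mpoly K[n]} -> {mpoly K[n]} :=
  fun f => tau (msym s (tauV f)).

End Tau.

(* The automorphism specified by [tau_spec] exists: its inverse on each cycle
   is the inverse discrete Fourier transform. *)
Section TauExists.
Variables (n : nat) (K : fieldType).

Let cyc (cs : seq (seq 'I_n)) (v : 'I_n) :=
  nth [::] cs (find (fun c => v \in c) cs).

Let dft cs k (a : nat -> K) (z : K) (p : {mpoly K[n]}) : {mpoly K[n]} :=
  p \mPo [tuple a (size (cyc cs v)) *:
            \sum_(j < size (cyc cs v))
              (z ^+ (k %/ size (cyc cs v))) ^+ (index v (cyc cs v) * j)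
              *: 'X_(nth v (cyc cs v) j) | v < n].

Let eq_lrmorph (f g : {lrmorphism {mpoly K[n]} -> {mpoly K[n]}}) :
  (forall i, f 'X_i = g 'X_i) -> f =1 g.
Proof.
move=> fg p; rewrite (mpolyE p) !linear_sum; apply: eq_bigr => m _.
rewrite !linearZ /= mpolyXE_id !rmorph_prod; congr (_ *: _).
by apply: eq_bigr => i _; rewrite !rmorphXn /= fg.
Qed.

Variables (s : 'S_n) (cs : seq (seq 'I_n)).
Hypothesis cs_s : cycle_decomposition s cs.

Let cs_uniq : uniq (flatten cs).
Proof. by case: cs_s => /perm_uniq-> _ _; apply: enum_uniq. Qed.

Let cycP v : cyc cs v \in cs /\ v \in cyc cs v.
Proof.
have h : has (fun c : seq 'I_n => v \in c) cs.
  apply/hasP; have : v \in flatten cs.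
    by case: cs_s => /perm_mem-> _ _; rewrite mem_enum.
  by case/flattenP => c cin vin; exists c.
by split; [rewrite mem_nth // -has_find | apply: (nth_find [::] h)].
Qed.

Let cyc_uniq c : c \in cs -> uniq c.
Proof.
move=> cin; have: subseq c (flatten cs); last by move/subseq_uniq; apply.
elim: (cs) cin => //= d ds IH; rewrite inE.
case/predU1P=> [->|/IH h]; first exact: prefix_subseq.
exact: subseq_trans h (suffix_subseq _ _).
Qed.

Let cyc_eq c v : c \in cs -> v \in c -> cyc cs v = c.
Proof.
have := cs_uniq; rewrite /cyc; elim: (cs) => //= d ds IH.
rewrite cat_uniq => /and3P[_ /hasPn dis uds]; rewrite inE.
case/predU1P=> [->|cin] vin; first by rewrite vin.
have /dis /= : v \in flatten ds by apply/flattenP; exists c.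
by case: ifP => // _ _; apply: IH.
Qed.

Let cyc_dvd c : c \in cs -> (size c %| #[s]%g)%N.
Proof.
case: (cs_s) => _ nc fc cin.
case: c cin (nc _ cin) (fc _ cin) (cyc_uniq cin) => // x c cin _ fcx ux.
have o : fingraph.order s x = (size c).+1.
  by rewrite (order_cycle fcx ux) // mem_head.
have it m : iter (m * fingraph.order s x) s x = x.
  by elim: m => // m IHm; rewrite mulSn iterD IHm iter_order //; apply: perm_inj.
have e : iter #[s]%g s x = x by rewrite -permX expg_order perm1.
rewrite /= -o /dvdn -[X in X == _](@findex_iter _ s x).
  have : iter (#[s]%g %% fingraph.order s x) s x = x.
    by rewrite -[RHS]e [in RHS](divn_eq #[s]%g (fingraph.order s x)) addnC iterD it.
  by move=> ->; rewrite findex0.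
by rewrite ltn_mod o.
Qed.

Let dftE k a z c e i : c \in cs -> (i < size c)%N ->
  dft cs k a z 'X_(nth e c i) = a (size c) *: \sum_(j < size c)
     (z ^+ (k %/ size c)) ^+ (i * j) *: 'X_(nth e c j).
Proof.
move=> cin ilt; rewrite /dft comp_mpolyXU -tnth_nth tnth_mktuple.
rewrite (cyc_eq cin) ?mem_nth // index_uniq ?cyc_uniq //; congr (_ *: _).
by apply: eq_bigr => j _; rewrite (set_nth_default e).
Qed.

Let dftK k (a b : nat -> K) (z w : K) : #[s]%g = k -> k.-primitive_root z ->
  z * w = 1 ->
  (forall c, c \in cs -> a (size c) * b (size c) * (size c)%:R = 1) ->
  cancel (dft cs k a z) (dft cs k b w).
Proof.
move=> ok zp zw ab p; rewrite -[RHS](comp_mpoly_id p).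
pose F : {lrmorphism {mpoly K[n]} -> {mpoly K[n]}} :=
  comp_mpoly [tuple a (size (cyc cs v)) *: \sum_(j < size (cyc cs v))
              (z ^+ (k %/ size (cyc cs v))) ^+ (index v (cyc cs v) * j)
              *: 'X_(nth v (cyc cs v) j) | v < n].
pose F' : {lrmorphism {mpoly K[n]} -> {mpoly K[n]}} :=
  comp_mpoly [tuple b (size (cyc cs v)) *: \sum_(j < size (cyc cs v))
              (w ^+ (k %/ size (cyc cs v))) ^+ (index v (cyc cs v) * j)
              *: 'X_(nth v (cyc cs v) j) | v < n].
pose G : {lrmorphism {mpoly K[n]} -> {mpoly K[n]}} :=
  comp_mpoly [tuple 'X_i | i < n].
suff: (F' \o F : {lrmorphism _ -> _}) =1 G by apply.
apply: eq_lrmorph => v.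
rewrite [RHS]comp_mpoly_id -[LHS]/(dft cs k b w (dft cs k a z 'X_v)).
have [cin vin] := cycP v; set c := cyc cs v in cin vin.
have sk := cyc_dvd cin; rewrite ok in sk.
pose l := size c; have lt_i : (index v c < l)%N by rewrite index_mem.
pose u := z ^+ (k %/ l); pose t := w ^+ (k %/ l).
have up : l.-primitive_root u := dvdn_prim_root zp sk.
have ut : u * t = 1 by rewrite -exprMn zw expr1n.
have tl : t ^+ l = 1.
  by rewrite -[LHS]mul1r -[X in X * _ = _](prim_expr_order up) -exprMn ut expr1n.
rewrite -{1}(nth_index v vin) dftE // -[dft _ _ b w _]/(F' _).
rewrite linearZ linear_sum /=.
under eq_bigr => j _.
  rewrite linearZ /= -[_ \mPo _]/(dft cs k b w _) dftE // !scalerA.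
  rewrite scaler_sumr; under eq_bigr do rewrite scalerA.
  over.
rewrite -/l -/u -/t exchange_big /= scaler_sumr (bigD1 (Ordinal lt_i)) //=.
rewrite [X in _ + X]big1 ?addr0 => [|j].
  rewrite -scaler_suml scalerA nth_index //.
  under eq_bigr => j _ do
    rewrite mulrAC [(j * _)%N]mulnC -exprMn ut expr1n mul1r.
  by rewrite sumr_const card_ord -mulr_natr mulrA ab // scale1r.
rewrite -val_eqE /= => ne_j.
rewrite -scaler_suml scalerA.
pose y := u ^+ index v c * t ^+ j.
under eq_bigr => i _ do rewrite mulrAC [(i * j)%N]mulnC !exprM -exprMn -/y.
have y1 : y != 1.
  apply/negP => /eqP y1; case/negP: ne_j; rewrite eq_sym.
  have wu : u ^+ j * t ^+ j = 1 by rewrite -exprMn ut expr1n.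
  have: u ^+ index v c == u ^+ j.
    apply/eqP/(@mulIf _ (t ^+ j)); last by rewrite wu.
    by apply: contra_eq_neq wu => ->; rewrite mulr0 eq_sym oner_eq0.
  by rewrite (eq_prim_root_expr up) !modn_small.
have yl : y ^+ l = 1.
  rewrite /y exprMn -!exprM [(index _ _ * _)%N]mulnC [(j * _)%N]mulnC !exprM.
  by rewrite (prim_expr_order up) tl !expr1n mulr1.
have /eqP := subrX1 y l; rewrite yl subrr eq_sym mulf_eq0 subr_eq0 (negPf y1).
by rewrite -mulr_suml => /eqP->; rewrite mul0r mulr0 scale0r.
Qed.

Lemma tau_exists (k : nat) (xi : K) :
    #[s]%g = k -> k.-primitive_root xi ->
  exists2 tau : {lrmorphism {mpoly K[n]} -> {mpoly K[n]}},
    bijective tau & tau_spec s cs k xi tau.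
Proof.
move=> ok xip.
have xi0 : xi != 0.
  apply: contra_eq_neq (prim_expr_order xip) => ->.
  by rewrite expr0n eqn0Ngt (prim_order_gt0 xip) eq_sym oner_eq0.
have k0 := prim_order_gt0 xip.
have xiVp : k.-primitive_root xi^-1.
  have->: xi^-1 = xi ^+ k.-1.
    by apply: (mulfI xi0); rewrite mulfV // -exprS prednK // prim_expr_order.
  rewrite prim_root_exp_coprime // coprime_sym.
  by rewrite -{1}(prednK k0) coprimeSn.
pose a := fun _ : nat => 1 : K; pose b := fun l : nat => (l%:R : K)^-1.
have ab c : c \in cs -> b (size c) * (size c)%:R = 1.
  move=> cin; apply: mulVf; have := cyc_dvd cin; rewrite ok => sk.
  by rewrite (prim_root_natf_neq0 (dvdn_prim_root xip sk)).
pose tau : {lrmorphism {mpoly K[n]} -> {mpoly K[n]}} :=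
  comp_mpoly [tuple a (size (cyc cs v)) *: \sum_(j < size (cyc cs v))
              (xi ^+ (k %/ size (cyc cs v))) ^+ (index v (cyc cs v) * j)
              *: 'X_(nth v (cyc cs v) j) | v < n].
exists tau.
  exists (dft cs k b xi^-1).
    by apply: (dftK ok xip); [rewrite mulfV | move=> c cin; rewrite mul1r ab].
  apply: (dftK (a := b) (b := a) ok xiVp); first by rewrite mulVf.
  by move=> c cin; rewrite mulr1 ab.
move=> e1 c cin l i ilt; rewrite -[LHS]/(dft cs k a xi _) dftE // scale1r.
apply: eq_bigr => j _; congr (_ *: 'X_ _).
case: cs_s => _ _ /(_ _ cin) fc; rewrite permX.
elim: (j : nat) (ltn_ord j) => //= m IHm mlt.
rewrite -IHm; last exact: ltnW.
have:= fc; rewrite /= -cats1 => /(pathP e1) /(_ m).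
rewrite size_cat addn1 => /(_ (ltnW mlt)) /eqP.
have -> : nth e1 (e1 :: c ++ [:: e1]) m = nth e1 (e1 :: c) m.
  by rewrite -cat_cons nth_cat /= (ltnW mlt).
by rewrite nth_cat -ltnS mlt.
Qed.

End TauExists.

(* Main.v *)
Require Import Defs.
From HB Require Import structures.
From mathcomp Require Import all_boot all_order all_fingroup all_algebra.
From mathcomp Require Import mpoly.

Set Implicit Arguments.
Unset Strict Implicit.
Unset Printing Implicit Defensive.

Import GRing.Theory.
Local Open Scope ring_scope.

(* The automorphism [sigma_tau] is diagonal: for a cycle of length l and
   zeta = xi^(k/l), both [tau \o sigma] and (x_{e_j} |-> zeta^j x_{e_j}) \o [tau]
   send x_{e_i} to \sum_j zeta^((i+1)j) x_{e_j}.  Hence it multiplies every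
   monomial by a power of xi.  If nu is the exponent attached to the leading
   monomial of g, then [sigma_tau g - xi^nu g] lies in I and is supported on
   the non-leading monomials of g, so it vanishes as G is reduced. *)

(** The fold in [lmon] starts from 0, the least monomial; on a nonempty support antisymmetry lets it
    win only if it occurs there. *)
Lemma lmon_msupp (n : nat) (K : fieldType) (le : rel 'X_{1..n})
    (f : {mpoly K[n]}) :
  is_monomial_order le -> f != 0 -> lmon le f \in msupp f.
Proof.
move=> [[le_refl le_anti _ _] le0 _]; rewrite -msupp_eq0 /lmon.
elim: (msupp f : seq _) => // m r IH _; rewrite big_cons.
case: ifP => [le_m|_]; last exact: mem_head.
case: r => [|m' r] in IH le_m *; last by rewrite inE IH ?orbT.
rewrite big_nil in le_m *; rewrite inE; apply/eqP/le_anti.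
by rewrite le0 le_m.
Qed.

Lemma lrmorph_mpolyX_eq (n : nat) (K : fieldType)
    (f g : {lrmorphism {mpoly K[n]} -> {mpoly K[n]}}) :
  (forall i, f 'X_i = g 'X_i) -> f =1 g.
Proof.
move=> fg p; rewrite [p]mpolyE !linear_sum; apply: eq_bigr => m _.
rewrite !linearZ /= mpolyXE_id !rmorph_prod; congr (_ *: _).
by apply: eq_bigr => i _; rewrite !rmorphXn /= fg.
Qed.

(** A cycle is a path along [rcons c x], hence a trajectory of [f]; the appended [x] gives the
    return after one full turn. *)
Lemma fcycle_iter (T : eqType) (f : T -> T) (x : T) (c : seq T) :
  fcycle f (x :: c) ->
  (forall i, (i < size (x :: c))%N -> nth x (x :: c) i = iter i f x) /\
  iter (size (x :: c)) f x = x.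
Proof.
move=> /fpathP[m Em]; have Ec : x :: rcons c x = traject f x m.+1 by rewrite Em.
have /eqP := congr1 size Em; rewrite size_rcons size_traject => /eqP Em'.
have nE i : (i < m.+1)%N -> nth x (x :: rcons c x) i = iter i f x.
  by move=> lt_i; rewrite Ec nth_traject.
split=> [i lt_i|]; last by rewrite /= -iterS Em' -nE // -Em' /= nth_rcons ltnn eqxx.
rewrite -nE -?Em' 1?ltnW //; case: i lt_i => //= i lt_i.
by rewrite nth_rcons -ltnS lt_i.
Qed.

(** With k the order of [s] and l the size of [c], [s ^+ k] fixes the head, so the entries at
    positions k mod l and 0 coincide; entries being distinct, k mod l = 0. *)
Lemma fcycle_size_dvd_order (T : finType) (s : {perm T}) (c : seq T) :
  uniq c -> c != [::] -> fcycle s c -> (size c %| #[s]%g)%N.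
Proof.
case: c => // x c uc _ /fcycle_iter[nE itl].
set l := size (x :: c) in nE itl *; set k := #[s]%g.
have itM q : iter (q * l) s x = x by elim: q => // q IH; rewrite mulSn iterD IH.
have : nth x (x :: c) (k %% l)%N = nth x (x :: c) 0.
  rewrite nE ?ltn_mod // -[RHS]/x -[in LHS](itM (k %/ l)%N) -iterD addnC -divn_eq.
  by rewrite -permX expg_order perm1.
by move/eqP; rewrite nth_uniq ?ltn_mod.
Qed.

Section DiagonalAction.
Variables (n : nat) (K : fieldType) (s : 'S_n) (k : nat) (xi : K).
Variable cs : seq (seq 'I_n).
Hypotheses (ord_s : #[s]%g = k) (xi_k : xi ^+ k = 1).
Hypothesis cs_s : cycle_decomposition s cs.

(* Only the cycle containing [v] contributes to the sum. *)
Definition cycle_weight (v : 'I_n) : nat :=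
  (\sum_(c <- cs | v \in c) k %/ size c * index v c)%N.

Definition monom_weight (m : 'X_{1..n}) : nat :=
  (\sum_(v < n) cycle_weight v * m v)%N.

Definition weight_action : {mpoly K[n]} -> {mpoly K[n]} :=
  comp_mpoly [tuple xi ^+ cycle_weight v *: 'X_v | v < n].

HB.instance Definition _ := GRing.LRMorphism.on weight_action.

(** With [c] moved to the front, its disjointness from all other cycles can be read off by
    [cat_uniq]. *)
Let uniq_rem c : c \in cs -> uniq (c ++ flatten (rem c cs)).
Proof.
case: cs_s => cs_enum _ _ cin.
rewrite -[_ ++ _]/(flatten (c :: _)) -(perm_uniq (perm_flatten (perm_to_rem cin))).
by rewrite (perm_uniq cs_enum) enum_uniq.
Qed.

Let cycle_uniq c : c \in cs -> uniq c.
Proof. by move/uniq_rem; rewrite cat_uniq => /andP[]. Qed.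

Lemma cycle_weightE c v : c \in cs -> v \in c ->
  cycle_weight v = (k %/ size c * index v c)%N.
Proof.
move=> cin vin; rewrite /cycle_weight (big_rem c) //= vin big1_seq ?addn0 //.
move=> d /andP[vd din]; have := uniq_rem cin; rewrite cat_uniq => /and3P[_ + _].
by case/hasP; exists v => //; apply/flattenP; exists d.
Qed.

Lemma weight_actionX m : weight_action 'X_[m] = xi ^+ monom_weight m *: 'X_[m].
Proof.
rewrite /weight_action comp_mpolyX [in RHS]mpolyXE_id /monom_weight -prodrXr.
rewrite -scaler_prod; apply: eq_bigr => v _.
by rewrite tnth_mktuple exprZn exprM.
Qed.

(** Diagonality in coefficient form: no new monomials appear, so [g] and its image can be compared
    one monomial at a time. *)
Lemma mcoeff_weight_action f m :
  (weight_action f)@_m = xi ^+ monom_weight m * f@_m.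
Proof.
rewrite [f in LHS]mpolyE [weight_action _]linear_sum [f in RHS]mpolyE.
rewrite !(raddf_sum (mcoeff m)) mulr_sumr.
apply: eq_bigr => m' _; rewrite linearZ /= weight_actionX !mcoeffZ mcoeffX.
by have [->|_] := eqVneq m' m; rewrite ?mulr0 // !mulr1 mulrC.
Qed.

Lemma tau_msym (tau : {lrmorphism {mpoly K[n]} -> {mpoly K[n]}}) :
  tau_spec s cs k xi tau ->
  forall f, tau (msym s f) = weight_action (tau f).
Proof.
move=> tauP; apply: (@lrmorph_mpolyX_eq _ _ (tau \o msym s) (weight_action \o tau)).
move=> v /=; have [cs_enum cs0 cs_fc] := cs_s.
have /flattenP[c cin vin] : v \in flatten cs.
  by rewrite (perm_mem cs_enum) mem_enum.
have uc := cycle_uniq cin; have l_dvd := fcycle_size_dvd_order uc (cs0 c cin) (cs_fc c cin).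
case: c => // e1 c in cin vin uc l_dvd *.
have [nE itl] := fcycle_iter (cs_fc _ cin); have tauE := tauP _ _ cin.
rewrite ord_s in l_dvd; set l := size (e1 :: c) in nE itl tauE l_dvd *.
set z := xi ^+ (k %/ l) in tauE.
have zl : z ^+ l = 1 by rewrite -exprM divnK.
rewrite -index_mem -/l in vin; set i := index v _ in vin.
have vE : v = nth e1 (e1 :: c) i by rewrite nth_index // -index_mem.
(* The variable at [(s ^+ j) e1] has index j in its cycle, hence eigenvalue [z ^+ j]. *)
have actE (j : 'I_l) :
    weight_action 'X_((s ^+ j)%g e1) = z ^+ j *: 'X_((s ^+ j)%g e1).
  rewrite permX -nE // /weight_action comp_mpolyXU -tnth_nth tnth_mktuple.
  by rewrite (cycle_weightE cin) ?mem_nth // index_uniq // exprM.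
have -> : msym s 'X_v = 'X_(s v) :> {mpoly K[n]}.
  by rewrite msymX; congr 'X_[_]; apply/mnmP => w; rewrite mnmE !mnm1E (can2_eq (permK s) (permKV s)).
(* [s] raises the index i to i+1; at the end of the cycle it wraps to 0, and [zl] makes the two
   formulas agree. *)
have -> : tau 'X_(s v) = \sum_(j < l) z ^+ (i.+1 * j) *: 'X_((s ^+ j)%g e1).
  have [lt_i|] := ltnP i.+1 l.
    by rewrite -tauE // nE // iterS -nE // vE.
  move=> le_l; have El : i.+1 = l by apply/eqP; rewrite eqn_leq vin.
  have -> : s v = nth e1 (e1 :: c) 0 by rewrite vE nE // -iterS El itl.
  rewrite tauE //; apply: eq_bigr => j _.
  by rewrite El mul0n expr0 exprM zl expr1n.
rewrite vE tauE // linear_sum; apply: eq_bigr => j _.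
by rewrite linearZ /= actE scalerA -exprD mulSn addnC.
Qed.

End DiagonalAction.

Theorem proposition3p8 (K : fieldType) (n : nat) (s : 'S_n) (k : nat)
  (ord_s : #[s]%g = k)
  (char_k : forall p, p \in [pchar K] -> ~~ (p %| k)%N)
  (xi : K) (xi_prim : k.-primitive_root xi)
  (cs : seq (seq 'I_n)) (cs_s : cycle_decomposition s cs)
  (tau : {lrmorphism {mpoly K[n]} -> {mpoly K[n]}})
  (tauP : tau_spec s cs k xi tau)
  (tauV : {mpoly K[n]} -> {mpoly K[n]})
  (tauK : cancel tau tauV) (tauVK : cancel tauV tau)
  (le : rel 'X_{1..n}) (le_deg : is_degree_order le)
  (I : {mpoly K[n]} -> Prop) (I_ideal : is_ideal I)
  (I_sym : symmetric_ideal (sigma_tau s tau tauV) I)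
  (G : seq {mpoly K[n]}) (G_gb : is_reduced_groebner_basis le G I) :
  forall g, g \in G ->
    exists2 nu : nat, (nu <= k - 1)%N & sigma_tau s tau tauV g = xi ^+ nu *: g.
Proof.
have xi_k := prim_expr_order xi_prim; have [le_mon _] := le_deg.
have [I0 ID IM] := I_ideal.
have stE f : sigma_tau s tau tauV f = weight_action k xi cs f.
  by rewrite /sigma_tau (tau_msym ord_s xi_k cs_s tauP) tauVK.
have [[GI GinI] [_ _ _ G_red]] := G_gb => g gG.
(* The eigenvalue of the leading monomial is the only candidate for [g]; reducing [w] mod k gives
   the bound and keeps the power of [xi]. *)
set w := monom_weight k cs (lmon le g).
exists (w %% k)%N; first by rewrite subn1 -ltnS prednK ?ltn_mod (prim_order_gt0 xi_prim).
rewrite (prim_expr_mod xi_prim); apply/eqP; rewrite -subr_eq0.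
set h := _ - _; apply/negPn/negP => h0.
have hm m : h@_m = (xi ^+ monom_weight k cs m - xi ^+ w) * g@_m.
  by rewrite mcoeffB mcoeffZ stE mcoeff_weight_action mulrBl.
have Ih : I h.
  apply: ID; first by apply/I_sym; exists g => //; apply: GI.
  by rewrite -scaleNr -mul_mpolyC; apply/IM/GI.
have lh := lmon_msupp le_mon h0.
(* Since [h] is in [I], its leading monomial is in the leading ideal of [G]; it remains to find it
   in the tail of [g]. *)
apply: (G_red g (lmon le h) gG); last by apply/GinI => J _; apply; exists h.
(* The factor in [hm] vanishes at [lmon le g], so [lmon le h] is another monomial of [g]. *)
rewrite mcoeff_msupp hm in lh; rewrite mcoeff_msupp mcoeffB mcoeffZ mcoeffX.
have [eq_l|_] := eqVneq (lmon le g); first by rewrite -eq_l subrr mul0r eqxx in lh.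
by rewrite mulr0 subr0; apply: contraNneq lh => ->; rewrite mulr0.
Qed.
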